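(* Let $n,k$ be integers with $n\geq 2$ and $n-1\geq k\geq 1$. There is a bijection between the set of distinguished internally ordered $k$-partitions of $\{1,2,\dots,n+k-1\}$ and the set of triples $(I,\sigma,D)$ where \begin{itemize} \item $I=i_1,i_2,\dots,i_n$ is a sublist of cardinality $n$ extracted from the list $1,2,\dots,n+k-1$; \item $\sigma$ is a permutation in the symmetric group $S_n$; \item $D$ is a sublist of cardinality $k-1$ extracted from the list $i_{\sigma(2)},\dots,i_{\sigma(n-1)}$ (in particular, for every $n\ge 2$, if $k=1$ then $D$ is the empty list). \end{itemize} Therefore the number of distinguished internally ordered $k$-partitions of $\{1,2,\dots,n+k-1\}$ is $$n!\binom{n-2}{k-1}\binom{n+k-1}{k-1}.$$
   Context: An internally ordered $k$-partition ($k\ge1$) of a finite set $X$ is an unordered partition $\{P_1,\dots,P_k\}$ of $X$ into $k$ (nonempty) parts together with a total ordering of the elements of $P_i$ for each $1\le i\le k$ (arbitrary, not related to any given order on $X$). It is admissible if every part has cardinality at least $2$. A distinguished internally ordered $k$-partition of $X$ is an admissible internally ordered $k$-partition of $X$ in which one of the parts is marked as distinguished (so it consists of a distinguished part together with an unordered collection of the remaining $k-1$ parts, all parts being internally totally ordered). A sublist extracted from a list is obtained by selecting some of its entries and keeping them in the order in which they appear in the list; thus $i_1<i_2<\dots<i_n$. For $n=2$ the list $i_{\sigma(2)},\dots,i_{\sigma(n-1)}$ is empty. *)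

(* Defs.v *)
From mathcomp Require Import all_boot all_fingroup.
Set Implicit Arguments.
Unset Strict Implicit.
Unset Printing Implicit Defensive.

Definition total_orderings (T : finType) (A : {set T}) : {set {set T * T}} :=
  [set r : {set T * T} | [&& r \subset setX A A,
     [forall x, forall y, ((x, y) \in r) && ((y, x) \in r) ==> (x == y)],
     [forall x, forall y, forall z,
        ((x, y) \in r) && ((y, z) \in r) ==> ((x, z) \in r)] &
     [forall x in A, forall y in A, ((x, y) \in r) || ((y, x) \in r)]]].

(* A pair (P, o): the set P of parts, and for each part A the graph o A of the *)
(* ordering of A. Outside P the function o takes the junk value set0 (this is  *)
(* what pfamily set0 imposes), so that two pairs are equal exactly when they   *)
(* have the same parts with the same orderings.                                *)
Definition ordered_parts (T : finType) : finType :=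
  ({set {set T}} * {ffun {set T} -> {set T * T}})%type.

Definition int_ordered_partitions (T : finType) (k : nat) (X : {set T}) :
    {set ordered_parts T} :=
  [set w : ordered_parts T | [&& partition w.1 X, #|w.1| == k &
     w.2 \in pfamily set0 (mem w.1) (fun A => mem (total_orderings A))]].

Definition admissible (T : finType) (w : ordered_parts T) : bool :=
  [forall A in w.1, 2 <= #|A|].

Definition distinguished_partitions (T : finType) (k : nat) (X : {set T}) :
    {set ordered_parts T * {set T}} :=
  [set z : ordered_parts T * {set T} |
     [&& z.1 \in int_ordered_partitions k X, admissible z.1 & z.2 \in z.1.1]].

(* {1, ..., m} inside 'I_m.+1 = {0, ..., m}; enum (segment m) is the list      *)
(* 1, ..., m in increasing order.                                              *)
Definition segment (m : nat) : {set 'I_m.+1} := [set i : 'I_m.+1 | 0 < i].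

(* The list i_(s 2), ..., i_(s (n-1)). Positions in I and arguments of s are   *)
(* numbered from 0, so the arguments 2, ..., n-1 are here 1, ..., n-2.         *)
Definition inner_list (T : Type) (n : nat) (I : n.-tuple T) (s : 'S_n) :
    seq T :=
  [seq tnth I (s j) | j : 'I_n <- enum 'I_n & (0 < j) && (j < n.-1)].

(* The lists from which I and D are extracted have no repeated entry, so an    *)
(* extracted sublist is determined by its values, as in subseq.                *)
Definition sublist_triples (n k : nat) :
    {set n.-tuple 'I_(n + k - 1).+1 * 'S_n * (k - 1).-tuple 'I_(n + k - 1).+1} :=
  [set t : n.-tuple 'I_(n + k - 1).+1 * 'S_n *
           (k - 1).-tuple 'I_(n + k - 1).+1 |
     subseq t.1.1 (enum (segment (n + k - 1))) && subseq t.2 (inner_list t.1.1 t.1.2)].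

(* Main.v *)
Require Import Defs.
From mathcomp Require Import all_boot all_fingroup.
Set Implicit Arguments.
Unset Strict Implicit.
Unset Printing Implicit Defensive.

(** View a part together with its ordering as a list. The distinguished list
    b_0 and the other lists h_1 :: b_1, ..., h_(k-1) :: b_(k-1), arranged so
    that their heads h_1 < ... < h_(k-1) increase, form a normal form of the
    distinguished partition: no choice of order remains. Removing the heads
    and concatenating leaves the word w = b_0 b_1 ... b_(k-1), in which b_0 has
    length at least 2 and every other b_i is nonempty. The heads are the
    complement of I, the word is I permuted by sigma, and D consists of the
    last elements of b_0, ..., b_(k-2); conversely w is cut after each element
    of D. The length conditions say exactly that D avoids the first and the
    last element of w. *)

(** * Lists of pairwise disjoint lists *)

Section SequencesOfLists.
Variable T : eqType.
Implicit Types (s : seq T) (L : seq (seq T)).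

Lemma uniq_flatten_inj L s1 s2 x : uniq (flatten L) ->
  s1 \in L -> s2 \in L -> x \in s1 -> x \in s2 -> s1 = s2.
Proof.
elim: L => //= s L IHL; rewrite cat_uniq => /and3P[_ /hasPn sL uL].
have disj t : t \in L -> x \in s -> x \notin t.
  move=> tL xs; apply/negP => xt.
  by have /sL/negP : x \in flatten L by apply/flattenP; exists t.
rewrite !inE => /predU1P[->|L1] /predU1P[->|L2] // x1 x2; last exact: IHL.
  by have := disj _ L2 x1; rewrite x2.
by have := disj _ L1 x2; rewrite x1.
Qed.

Lemma uniq_flatten_mem L s : uniq (flatten L) -> s \in L -> uniq s.
Proof.
elim: L => //= t L IHL; rewrite cat_uniq => /and3P[ut _ uL].
by rewrite inE => /predU1P[->|] //; apply: IHL.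
Qed.

(** A nonempty list occurring twice would repeat its first entry in the concatenation. *)
Lemma uniq_flatten_uniq L : uniq (flatten L) -> all (leq 2 \o size) L -> uniq L.
Proof.
elim: L => //= s L IHL; rewrite cat_uniq => /and3P[_ /hasPn sL uL].
case/andP=> s2 L2; rewrite IHL // andbT; apply/negP => s_in.
case: s s2 sL s_in => //= x s _ sL s_in.
suff /sL : x \in flatten L by rewrite /= mem_head.
by apply/flattenP; exists (x :: s); rewrite ?mem_head.
Qed.

(** Induction on [s1]: the image of its first entry occurs only once among the images, so equal
    membership forces the two first entries to coincide. *)
Lemma eq_map_uniq (S : eqType) (h : T -> S) s1 s2 :
  uniq (map h s1) -> map h s1 = map h s2 -> s1 =i s2 -> s1 = s2.
Proof.
elim: s1 s2 => [|x s1 IHs] [|y s2] //= /andP[hx u1] [hxy h12] eq12.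
have /negPf xNs1 : x \notin s1 by apply: contra hx; apply: map_f.
have xy : x = y.
  have := eq12 x; rewrite mem_head inE => /esym/predU1P[//|/(map_f h)].
  by rewrite -h12 (negPf hx).
subst y; have /negPf xNs2 : x \notin s2.
  by apply/negP => /(map_f h); rewrite -h12 (negPf hx).
rewrite (IHs s2) // => z; have := eq12 z; rewrite !inE.
by case: eqP => // ->; rewrite xNs1 xNs2.
Qed.

End SequencesOfLists.

(** * Total orderings of a set and duplicate-free lists *)

Section ListOrders.
Variable T : finType.
Implicit Types (s : seq T) (A : {set T}) (r : {set T * T}).

Definition list_order s : {set T * T} :=
  [set p | [&& p.1 \in s, p.2 \in s & index p.1 s <= index p.2 s]].

Lemma in_list_order s x y : ((x, y) \in list_order s) =
  [&& x \in s, y \in s & index x s <= index y s].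
Proof. by rewrite inE. Qed.

Lemma list_order_total s : list_order s \in total_orderings [set x in s].
Proof.
rewrite inE; apply/and4P; split.
- by apply/subsetP => -[x y]; rewrite !inE /= => /and3P[-> ->].
- apply/'forall_forallP => x y; apply/implyP; rewrite !inE /=.
  case/andP=> /and3P[xs ys xy] /and3P[_ _ yx].
  by apply/eqP/(index_inj x xs ys)/eqP; rewrite eqn_leq xy.
- apply/'forall_'forall_forallP => x y z; apply/implyP; rewrite !inE /=.
  case/andP=> /and3P[-> ys xy] /and3P[_ -> yz].
  exact: leq_trans xy yz.
- apply/'forall_implyP => x; rewrite inE => xs.
  apply/'forall_implyP => y; rewrite inE => ys.
  by rewrite !inE /= xs ys leq_total.
Qed.

(** Both lists are sorted for the common relation, which is transitive and antisymmetric, and its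
    diagonal gives their members. Two sorted permutations of each other are equal. *)
Lemma list_order_inj s1 s2 : uniq s1 -> uniq s2 ->
  list_order s1 = list_order s2 -> s1 = s2.
Proof.
move=> u1 u2 eq12; pose e x y := (x, y) \in list_order s1.
have sort_e s : uniq s -> list_order s = list_order s1 -> sorted e s.
  rewrite /e; case: s => // x s us <-; apply/(sortedP x) => i lt_i.
  have lt_i' := ltnW lt_i.
  by rewrite in_list_order !mem_nth ?index_uniq ?leqnSn.
apply: (@sorted_eq _ e); first 1 last.
- move=> x y; rewrite /e !inE /= => /andP[/and3P[xs ys xy] /and3P[_ _ yx]].
  by apply/(index_inj x xs ys)/eqP; rewrite eqn_leq xy.
- exact: sort_e.
- exact: sort_e.
- apply: uniq_perm => // x; have := congr1 (fun r => (x, x) \in r) eq12.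
  by rewrite !inE /= !leqnn !andbT !andbb.
- move=> y x z; rewrite /e !inE /= => /and3P[-> ys xy] /and3P[_ -> yz].
  exact: leq_trans xy yz.
Qed.

Definition order_list A r : seq T := sort (fun x y => (x, y) \in r) (enum A).

Lemma order_list_set A r : [set x in order_list A r] = A.
Proof. by apply/setP => x; rewrite inE mem_sort mem_enum. Qed.

Lemma order_listK A r :
  r \in total_orderings A -> list_order (order_list A r) = r.
Proof.
rewrite inE => /and4P[/subsetP rA /'forall_forallP anti].
move=> /'forall_'forall_forallP tr /'forall_implyP tot.
have {}anti x y : (x, y) \in r -> (y, x) \in r -> x = y.
  by move=> xy yx; have /implyP := anti x y; rewrite xy yx => /(_ isT)/eqP.
have {}tr : transitive (fun x y => (x, y) \in r).
  by move=> y x z xy yz; have /implyP := tr x y z; rewrite xy yz; apply.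
have {}tot x y : x \in A -> y \in A -> ((x, y) \in r) || ((y, x) \in r).
  by move=> xA; have /'forall_implyP := tot x xA; apply.
have memA x : (x \in order_list A r) = (x \in A) by rewrite mem_sort mem_enum.
have srt : sorted (fun x y => (x, y) \in r) (order_list A r).
  apply: (@sort_sorted_in _ (mem A)) => [x y|]; first exact: tot.
  by apply/allP => x; rewrite mem_enum.
apply/setP => -[x y]; rewrite inE /= !memA; apply/and3P/idP => [[xA yA xy]|xy].
  apply: (sorted_leq_index_in _ _ srt); rewrite ?memA //.
    by move=> ? ? ? _ _ _; apply: tr.
  by move=> z; rewrite memA => zA; have := tot _ _ zA zA; rewrite orbb.
(* Otherwise [y] comes strictly before [x], so [(y, x)] is in [r] by sortedness, and antisymmetry
   gives [x = y], which is absurd. *)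
have /setXP[xA yA] := rA _ xy; split=> //; rewrite leqNgt; apply/negP => yx.
have rxy := sorted_ltn_index tr srt _ _ _ _ yx.
by move: yx; rewrite (anti x y) ?ltnn // rxy ?memA.
Qed.

End ListOrders.

(** * Ordered partitions presented by lists *)

Section ListsToPartitions.
Variables (T : finType) (X : {set T}).
Implicit Types (L : seq (seq T)).

(** The relation at [A] is the union of the orders of all lists with entry set [A]. It is empty when
    [A] is not a part, which gives the required junk value [set0]. *)
Definition parts_of L : ordered_parts T :=
  ([set A | A \in [seq [set x in s] | s <- L]],
   [ffun A => [set p | has (fun s => ([set x in s] == A)
                                     && (p \in list_order s)) L]]).

(** The single permutation condition says that the entry sets cover [X], that they are disjoint and
    that no list repeats an entry. *)
Definition block_lists L :=
  perm_eq (flatten L) (enum X) && all (leq 2 \o size) L.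

Variable L : seq (seq T).
Hypothesis bL : block_lists L.

Let uL : uniq (flatten L).
Proof. by case/andP: bL => /perm_uniq->; rewrite enum_uniq. Qed.

Lemma block_lists_nonempty s : s \in L -> exists x, x \in s.
Proof.
case/andP: bL => _ /allP bs /bs/=.
by case: s => // x s _; exists x; apply: mem_head.
Qed.

Lemma block_lists_inj s1 s2 : s1 \in L -> s2 \in L ->
  [set x in s1] = [set x in s2] -> s1 = s2.
Proof.
move=> L1 L2 eq12; have [x xs1] := block_lists_nonempty L1.
apply: (uniq_flatten_inj uL L1 L2 xs1).
by have /setP/(_ x) := eq12; rewrite !inE xs1.
Qed.

Lemma mem_parts_of A :
  reflect (exists2 s, s \in L & A = [set x in s]) (A \in (parts_of L).1).
Proof. by rewrite inE; apply: mapP. Qed.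

Lemma parts_of_order s : s \in L -> (parts_of L).2 [set x in s] = list_order s.
Proof.
move=> sL; apply/setP => p; rewrite ffunE inE.
apply/hasP/idP => [[t tL /andP[/eqP/block_lists_inj->]]|ps] //.
by exists s; rewrite ?eqxx.
Qed.

Lemma parts_of_partition :
  parts_of L \in int_ordered_partitions (size L) X.
Proof.
have memX x : (x \in flatten L) = (x \in X).
  by case/andP: bL => /perm_mem-> _; rewrite mem_enum.
rewrite inE; apply/and3P; split.
- apply/and3P; split.
  + apply/eqP/setP => x; rewrite -memX; apply/bigcupP/flattenP.
      by move=> [_ /mem_parts_of[s sL ->]]; rewrite inE; exists s.
    move=> [s sL xs]; exists [set y in s]; rewrite ?inE //.
    by apply/mapP; exists s.
  + apply/trivIsetP => _ _ /mem_parts_of[s sL ->] /mem_parts_of[t tL ->] st.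
    apply/pred0P => x /=; rewrite !inE; apply/negP => /andP[xs xt].
    by rewrite (uniq_flatten_inj uL sL tL xs xt) eqxx in st.
  + apply/mem_parts_of => -[s /block_lists_nonempty[x xs] /setP/(_ x)].
    by rewrite !inE xs.
- rewrite cardsE; have /card_uniqP-> : uniq [seq [set x in s] | s <- L].
    rewrite map_inj_in_uniq; first by case/andP: bL => _ /uniq_flatten_uniq->.
    exact: block_lists_inj.
  by rewrite size_map.
- apply/pfamilyP; split=> [|_ /mem_parts_of[s sL ->]]; last first.
    by rewrite parts_of_order // list_order_total.
  apply/subsetP => A; rewrite !inE ffunE => /set0Pn[p]; rewrite inE.
  by case/hasP=> s sL /andP[/eqP<- _]; apply: map_f.
Qed.

Lemma parts_of_admissible : admissible (parts_of L).
Proof.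
apply/'forall_implyP => _ /mem_parts_of[s sL ->]; rewrite cardsE.
have /card_uniqP-> := uniq_flatten_mem uL sL.
by case/andP: bL => _ /allP/(_ _ sL).
Qed.

End ListsToPartitions.

(** Only membership can be compared, since [parts_of] forgets the order in which the lists are
    arranged. *)
Lemma parts_of_sub (T : finType) (X : {set T}) (L M : seq (seq T)) :
  block_lists X L -> block_lists X M -> parts_of L = parts_of M ->
  {subset L <= M}.
Proof.
move=> bL bM eqLM s sL.
have : [set x in s] \in (parts_of M).1.
  by rewrite -eqLM; apply/mem_parts_of; exists s.
case/mem_parts_of=> t tM st; suff -> : s = t by [].
have [/andP[/perm_uniq uL _] /andP[/perm_uniq uM _]] := (bL, bM).
rewrite enum_uniq in uL uM.
apply: list_order_inj.
- exact: uniq_flatten_mem sL.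
- exact: uniq_flatten_mem tM.
- by rewrite -(parts_of_order bL sL) eqLM st (parts_of_order bM tM).
Qed.

(** * Normal forms of distinguished partitions *)

Section NormalForms.
Variables (T : finType) (X : {set T}) (k : nat).
Implicit Types c : seq T * seq (T * seq T).

(** Heads are stored apart from tails, so that [unzip1] extracts the increasing h_i and [unzip2] the
    b_i to be concatenated. *)
Definition lists_of c : seq (seq T) := c.1 :: [seq b.1 :: b.2 | b <- c.2].

(** Here [k] counts the nondistinguished lists, one less than the number of parts. Being a sublist
    of [enum X] is how the heads are made increasing. *)
Definition normal_form c :=
  [&& block_lists X (lists_of c), size c.2 == k & subseq (unzip1 c.2) (enum X)].

Definition decode c : ordered_parts T * {set T} :=
  (parts_of (lists_of c), [set x in c.1]).

Lemma decode_distinguished c :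
  normal_form c -> decode c \in distinguished_partitions k.+1 X.
Proof.
case/and3P=> bL /eqP sz _; rewrite inE; apply/and3P; split.
- by have := parts_of_partition bL; rewrite /= size_map sz.
- exact: parts_of_admissible bL.
- by apply/mem_parts_of; exists c.1; rewrite ?mem_head.
Qed.

Lemma decode_blocks_sub c c' : normal_form c -> normal_form c' ->
  decode c = decode c' -> c.1 = c'.1 /\ {subset c.2 <= c'.2}.
Proof.
case/and3P=> bL _ _ /and3P[bL' _ _] [eq1 eq2].
have eqc : parts_of (lists_of c) = parts_of (lists_of c').
  by rewrite /parts_of eq1 eq2.
have sub := parts_of_sub bL bL' eqc.
move=> eqd; have eqc1 : c.1 = c'.1.
  by apply: (block_lists_inj bL') => //; rewrite ?mem_head // sub ?mem_head.
split=> // -[x t] bc.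
have : x :: t \in lists_of c'.
  by apply: sub; rewrite inE (map_f (fun b => b.1 :: b.2) bc) orbT.
rewrite inE => /predU1P[|/mapP[[y u] yu [-> ->]]] //.
(* The list [x :: t] cannot be the distinguished one: that list would then occur twice in
   [lists_of c], whose members are distinct. *)
rewrite -eqc1 => xt; case/andP: bL => /perm_uniq uL.
rewrite enum_uniq in uL => /(uniq_flatten_uniq uL)/= /andP[/negP[]].
by rewrite -xt (map_f (fun b => b.1 :: b.2) bc).
Qed.

(** The heads of both forms are the same set listed in the order of [enum X], hence the same list;
    being distinct, they fix the order of the pairs. *)
Lemma decode_inj c c' : normal_form c -> normal_form c' ->
  decode c = decode c' -> c = c'.
Proof.
move=> nc nc' eqcc'.
have [eq1 sub] := decode_blocks_sub nc nc' eqcc'.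
have [_ sub'] := decode_blocks_sub nc' nc (esym eqcc').
have eq2 : c.2 =i c'.2 by move=> b; apply/idP/idP; [apply: sub | apply: sub'].
case/and3P: nc nc' => _ _ h /and3P[_ _ h'].
have uX : uniq (enum X) by rewrite enum_uniq.
suff e2 : c.2 = c'.2.
  by rewrite [c]surjective_pairing eq1 e2 -surjective_pairing.
apply: (@eq_map_uniq _ _ fst) => //; first exact: subseq_uniq h uX.
rewrite -/unzip1 (subseq_uniqP uX h) (subseq_uniqP uX h').
by apply: eq_filter; apply: eq_mem_map.
Qed.

Lemma decode_surj z : z \in distinguished_partitions k.+1 X ->
  exists2 c, normal_form c & z = decode c.
Proof.
case: z => [[P o] d]; rewrite !inE /= => /and3P[/and3P[PX /eqP cardP]].
case/pfamilyP=> [/subsetP o_supp o_ord] /'forall_implyP/= P2 dP.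
have [/eqP covP trivP _] := and3P PX.
pose bl A := order_list A (o A).
have blP A : A \in P -> list_order (bl A) = o A by move=> /o_ord/order_listK.
have bl_inj : injective bl.
  by move=> A B /(congr1 (fun s => [set x in s])); rewrite !order_list_set.
have size_bl A : size (bl A) = #|A| by rewrite size_sort cardE.
have mem_bl A x : (x \in bl A) = (x \in A) by rewrite mem_sort mem_enum.
(* A heading is the first entry of a block other than [d]. The default of [head] is harmless: below,
   [x] ranges over [X], where its block is nonempty. *)
pose heading x := (pblock P x != d) && (head x (bl (pblock P x)) == x).
pose c := (bl d, [seq (x, behead (bl (pblock P x))) | x <- enum X & heading x]).
have blockE x : x \in X -> heading x ->
    x :: behead (bl (pblock P x)) = bl (pblock P x).
  rewrite -covP -mem_pblock -mem_bl => + /andP[_ /eqP].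
  by case: (bl _) => //= y s _ ->.
have lists_c : lists_of c = 
    bl d :: [seq bl (pblock P x) | x <- enum X & heading x].
  rewrite /lists_of /= -map_comp; congr (_ :: _); apply/eq_in_map => x.
  by rewrite mem_filter mem_enum /= => /andP[hx xX]; apply: blockE.
have perm_c : perm_eq (lists_of c) [seq bl A | A <- enum P].
  apply: uniq_perm; last 1 first.
  - move=> s; rewrite lists_c inE; apply/predU1P/mapP => [[->|/mapP[x]]|].
    + by exists d; rewrite ?mem_enum.
    + rewrite mem_filter mem_enum -covP => /andP[_ xX] ->.
      by exists (pblock P x); rewrite // mem_enum pblock_mem.
    + move=> [A]; rewrite mem_enum => AP ->; have [->|Ad] := eqVneq A d.
        by left.
      right; have := P2 _ AP; rewrite -size_bl.
      case blA: (bl A) => [|x t] // _; rewrite -blA.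
      have xA : x \in A by rewrite -mem_bl blA mem_head.
      have pA := def_pblock trivP AP xA.
      apply/mapP; exists x; rewrite ?pA // mem_filter mem_enum -covP.
      rewrite -mem_pblock pA xA andbT /heading pA Ad blA /=; exact: eqxx.
  - rewrite lists_c cons_uniq; apply/andP; split.
      apply/mapP => -[x]; rewrite mem_filter => /andP[/andP[/eqP pd _] _].
      by move=> /bl_inj /esym.
    rewrite map_inj_in_uniq; first by rewrite filter_uniq // enum_uniq.
    move=> x y.
    rewrite !(mem_filter heading) !mem_enum => /andP[hx xX] /andP[hy yX].
    by rewrite -(blockE x) // -(blockE y) // => -[].
  - by rewrite (map_inj_uniq bl_inj) enum_uniq.
have bL : block_lists X (lists_of c).
  apply/andP; split; last first.
    rewrite (perm_all _ perm_c); apply/allP => s /mapP[A].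
    by rewrite mem_enum => AP -> /=; rewrite size_bl P2.
  apply: perm_trans (perm_flatten perm_c) _.
  have mem_X x : (x \in flatten [seq bl A | A <- enum P]) = (x \in X).
    rewrite -covP; apply/flattenP/bigcupP => [[_ /mapP[A AP ->]]|[A AP xA]].
      by rewrite mem_bl; rewrite mem_enum in AP; exists A.
    by exists (bl A); rewrite ?mem_bl // map_f ?mem_enum.
  apply: uniq_perm; [|exact: enum_uniq|by move=> x; rewrite mem_X mem_enum].
  (* Freedom from repetition follows by counting: the concatenation contains all of [X], and its
     length is the sum of the block sizes, that is, the cardinality of [X]. *)
  apply: (leq_size_uniq (enum_uniq X)) => [x|]; first by rewrite mem_X mem_enum.
  rewrite size_flatten /shape -map_comp sumnE big_map big_enum /=.
  by rewrite -cardE (card_partition PX) (eq_bigr _ (fun A _ => size_bl A)).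
have mem_c s : (s \in lists_of c) = (s \in [seq bl A | A <- enum P]).
  exact: perm_mem perm_c s.
exists c.
  apply/and3P; split=> //.
    have := perm_size perm_c; rewrite /= size_map [RHS]size_map -cardE cardP.
    by case=> ->.
  rewrite /unzip1 -map_comp (eq_map (g := id)) // map_id; exact: filter_subseq.
rewrite /decode order_list_set; congr (_, _, _).
  apply/setP => A; apply/idP/mem_parts_of => [AP|[s]].
    by exists (bl A); rewrite ?order_list_set // mem_c map_f ?mem_enum.
  rewrite mem_c => /mapP[B]; rewrite mem_enum => BP -> ->.
  by rewrite order_list_set.
apply/ffunP => A; have [AP|AP] := boolP (A \in P).
  rewrite -{2}[A](order_list_set A (o A)) (parts_of_order bL) ?blP //.
  by rewrite mem_c -/(bl A) map_f ?mem_enum.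
transitivity (set0 : {set T * T}).
  by apply/eqP; apply: contraR AP => /o_supp.
apply/esym/setP => p; rewrite ffunE !inE; apply/hasP => -[s].
rewrite mem_c => /mapP[B]; rewrite mem_enum => BP -> /andP[/eqP BA _].
by move: AP; rewrite -BA order_list_set BP.
Qed.

End NormalForms.

(** * Cutting a word after chosen letters *)

Section Cutting.
Variable T : eqType.
Implicit Types (w u D b : seq T) (L : seq (seq T)).

Fixpoint cut_after w D : seq (seq T) :=
  if D is d :: D' then
    take (index d w).+1 w :: cut_after (drop (index d w).+1 w) D'
  else [:: w].

Fixpoint cut_points x0 L : seq T :=
  if L is b :: L' then
    if L' is _ :: _ then last x0 b :: cut_points x0 L' else [::]
  else [::].

Lemma flatten_cut_after w D : flatten (cut_after w D) = w.
Proof.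
elim: D w => [|d D IHD] w /=; first exact: cats0.
by rewrite IHD cat_take_drop.
Qed.

Lemma size_cut_after w D : size (cut_after w D) = (size D).+1.
Proof. by elim: D w => //= d D IHD w; rewrite IHD. Qed.

(** Greedy matching: if [d :: D] embeds in [w], then [d] can be sent to its first occurrence. *)
Lemma subseq_cons_drop d D w :
  subseq (d :: D) w = (d \in w) && subseq D (drop (index d w).+1 w).
Proof.
elim: w => //= y w IHw; rewrite inE (eq_sym y d).
by case: (d == y); rewrite //= drop0.
Qed.

(** Every piece but the last ends with its letter of [D], and the last contains [z], since all cuts
    fall inside [u]. *)
Lemma cut_after_nonempty u z D :
  subseq D u -> all (leq 1 \o size) (cut_after (rcons u z) D).
Proof.
elim: D u => [|d D IHD] u; first by rewrite /= size_rcons.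
rewrite subseq_cons_drop => /andP[du Du] /=.
have lt_du : index d u < size u by rewrite index_mem.
rewrite -cats1 index_cat du cats1 drop_rcons // IHD // andbT.
by rewrite size_take size_rcons; case: ifP.
Qed.

(** As [a] is not a letter of [D], the first piece goes beyond [a]: up to the first letter of [D],
    or to [z] if there is no cut. *)
Lemma size_head_cut_after a u z D : a \notin u -> subseq D u ->
  2 <= size (head [::] (cut_after (a :: rcons u z) D)).
Proof.
case: D => [|d D] aNu /=; first by rewrite size_rcons.
move=> /mem_subseq/(_ _ (mem_head d D)) du.
have /negPf-> : a != d by apply: contraNneq aNu => ->.
by case: u {aNu du}.
Qed.

Lemma last_take_index x0 d w : d \in w -> last x0 (take (index d w).+1 w) = d.
Proof.
move=> dw; have lt_dw : index d w < size w by rewrite index_mem.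
by rewrite (take_nth x0) // last_rcons nth_index.
Qed.

Lemma cut_afterK x0 w D : subseq D w -> cut_points x0 (cut_after w D) = D.
Proof.
elim: D w => //= d D IHD w; rewrite subseq_cons_drop => /andP[dw Dw].
have := IHD _ Dw; have := size_cut_after (drop (index d w).+1 w) D.
by case: (cut_after _ D) => // b L _ ->; rewrite last_take_index.
Qed.

Lemma cut_pointsK x0 L : uniq (flatten L) -> all (leq 1 \o size) L ->
  L != [::] -> cut_after (flatten L) (cut_points x0 L) = L.
Proof.
case: L => // b L + + _; elim: L b => [|b' L IHL] b; first by rewrite /= cats0.
rewrite [flatten _]/= cat_uniq => /and3P[ub _ uL] /= /andP[b1 bL].
(* No letter of [b] repeats, so its last letter is first met at position [(size b).-1], and the cut
   falls at the end of [b]. *)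
have -> : index (last x0 b) (b ++ b' ++ flatten L) = (size b).-1.
  rewrite index_cat; case: b ub b1 => // x b ub _.
  by rewrite [last _ _]/= mem_last index_last.
rewrite prednK // take_size_cat // drop_size_cat //.
by rewrite -/(flatten (b' :: L)) (IHL b').
Qed.

Lemma cut_points_subseq x0 L u z : all (leq 1 \o size) L ->
  flatten L = rcons u z -> subseq (cut_points x0 L) u.
Proof.
elim: L u => [|b [|b' L] IHL] u; rewrite ?sub0seq //.
case/andP=> b1 bL; rewrite -[flatten _]/(b ++ flatten (b' :: L)).
rewrite -[cut_points _ _]/([:: last x0 b] ++ cut_points x0 (b' :: L)).
have : 0 < size (flatten (b' :: L)) by case: (b') bL.
case: (lastP (flatten (b' :: L))) IHL => // v y IHL _.
rewrite -rcons_cat => /rcons_inj[<- yz]; rewrite yz in IHL.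
apply: cat_subseq; last exact: IHL.
by case: (b) b1 => // x c _; rewrite sub1seq; apply: mem_last x c.
Qed.

End Cutting.

(** * Triples and normal forms *)

Section Triples.
Variable T : finType.

Lemma perm_flatten_blocks (ss : seq (T * seq T)) :
  perm_eq (flatten [seq b.1 :: b.2 | b <- ss])
          (unzip1 ss ++ flatten (unzip2 ss)).
Proof.
elim: ss => //= -[x t] ss IHss /=; rewrite perm_cons.
rewrite -[X in perm_eq _ X]/(_ ++ (t ++ _)).
by rewrite perm_sym perm_catCA perm_cat2l perm_sym.
Qed.

(** A sublist of a duplicate-free list is determined by its set of entries, and every subset of size
    [k] arises by filtering [s]. *)
Lemma card_sublists (k : nat) (s : seq T) : uniq s ->
  #|[set t : k.-tuple T | subseq t s]| = 'C(size s, k).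
Proof.
move=> us; pose f (t : k.-tuple T) := [set x in t].
have szs : #|[set x in s]| = size s by rewrite cardsE (card_uniqP us).
rewrite -szs -cards_draws -(card_in_imset (f := f)).
  apply: eq_card => A; rewrite [RHS]inE.
  apply/imsetP/andP => [[t]|[/subsetP As /eqP Ak]].
    rewrite inE => ts ->; split.
      by apply/subsetP => x; rewrite !inE => /(mem_subseq ts).
    by rewrite cardsE (card_uniqP (subseq_uniq ts us)) size_tuple.
  have perm_A : perm_eq [seq x <- s | x \in A] (enum A).
    apply: uniq_perm; [exact: filter_uniq | exact: enum_uniq | move=> x].
    by rewrite mem_filter mem_enum andb_idr // => /As; rewrite inE.
  have szA : size [seq x <- s | x \in A] == k.
    by rewrite (perm_size perm_A) -cardE Ak.
  exists (Tuple szA); first by rewrite inE filter_subseq.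
  by apply/setP => x; rewrite inE (perm_mem perm_A) mem_enum.
move=> t t'; rewrite !inE => ts ts' /setP eqt; apply: val_inj => /=.
rewrite (subseq_uniqP us ts) (subseq_uniqP us ts').
by apply: eq_filter => x; have := eqt x; rewrite !inE.
Qed.

Definition word (n : nat) (I : n.-tuple T) (s : 'S_n) : seq T :=
  [seq tnth I (s j) | j <- enum 'I_n].

Lemma size_word n (I : n.-tuple T) s : size (word I s) = n.
Proof. by rewrite size_map size_enum_ord. Qed.

(** The positions 0 and p+1 are exactly those rejected by the filter in [inner_list]; they give [a]
    and [z]. *)
Lemma word_inner_list p (I : p.+2.-tuple T) (s : 'S_p.+2) :
  exists a z, word I s = a :: rcons (inner_list I s) z.
Proof.
rewrite /word /inner_list enum_ordSl enum_ordSr /= map_rcons.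
set js := [seq lift ord0 i | i <- _].
rewrite filter_rcons ltnn andbF.
have /all_filterP-> : all (fun j : 'I_p.+2 => (0 < j) && (j < p.+1)) js.
  by apply/allP => _ /mapP[_ /mapP[i _ ->] ->] /=; rewrite /bump /= ltnS.
by rewrite map_rcons; do 2!eexists.
Qed.

Lemma perm_word n (I : n.-tuple T) s : perm_eq (word I s) I.
Proof. by apply/tuple_permP; exists s. Qed.

Lemma word_surj n (I : n.-tuple T) w : perm_eq w I -> exists s, w = word I s.
Proof. by move/tuple_permP. Qed.

Lemma word_inj n (I : n.-tuple T) : uniq I -> injective (word I).
Proof.
move=> uI s s' /eq_in_map eq_ss'; apply/permP => j.
by apply: (tuple_uniqP _ uI); apply: eq_ss'; rewrite mem_enum.
Qed.

Variables (X : {set T}) (n k : nat).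
Hypotheses (n_gt1 : 1 < n) (cardX : #|X| = n + k).
Implicit Types t : n.-tuple T * 'S_n * k.-tuple T.

Definition list_triples := [set t : n.-tuple T * 'S_n * k.-tuple T |
  subseq t.1.1 (enum X) && subseq t.2 (inner_list t.1.1 t.1.2)].

Definition encode t : seq T * seq (T * seq T) :=
  let bs := cut_after (word t.1.1 t.1.2) t.2 in
  (head [::] bs, zip [seq x <- enum X | x \notin t.1.1] (behead bs)).

Lemma inner_list_word (I : n.-tuple T) s :
  exists a z, word I s = a :: rcons (inner_list I s) z.
Proof.
by case: n n_gt1 I s => [|[|p]] // _ I s; apply: word_inner_list.
Qed.

Lemma perm_headings t : t \in list_triples ->
  perm_eq (enum X) ([seq x <- enum X | x \notin t.1.1] ++ t.1.1).
Proof.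
rewrite inE => /andP[/(subseq_uniqP (enum_uniq X)) It _].
by rewrite [X in _ ++ X]It perm_sym perm_catC (perm_filterC (mem t.1.1)).
Qed.

Lemma size_headings t : t \in list_triples ->
  size [seq x <- enum X | x \notin t.1.1] = k.
Proof.
move=> /perm_headings/perm_size; rewrite -cardE cardX size_cat size_tuple.
by rewrite addnC => /addIn.
Qed.

Lemma cut_encode t : t \in list_triples ->
  cut_after (word t.1.1 t.1.2) t.2 = (encode t).1 :: unzip2 (encode t).2.
Proof.
move=> tt; have := size_cut_after (word t.1.1 t.1.2) t.2.
rewrite /encode; case: (cut_after _ _) => //= b bs.
by rewrite size_tuple => -[sz]; rewrite unzip2_zip ?size_headings ?sz.
Qed.

Lemma headings_encode t : t \in list_triples ->
  unzip1 (encode t).2 = [seq x <- enum X | x \notin t.1.1].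
Proof.
move=> tt; rewrite unzip1_zip // size_headings // size_behead.
by rewrite size_cut_after size_tuple.
Qed.

Lemma word_encode t : t \in list_triples ->
  word t.1.1 t.1.2 = (encode t).1 ++ flatten (unzip2 (encode t).2).
Proof. by move/cut_encode/(congr1 flatten); rewrite flatten_cut_after. Qed.

Lemma encode_normal t : t \in list_triples -> normal_form X k (encode t).
Proof.
move=> tt; have heads_t := headings_encode tt.
have := tt; rewrite inE => /andP[It Dt].
have [a [z wE]] := inner_list_word t.1.1 t.1.2.
have uw : uniq (word t.1.1 t.1.2).
  by rewrite (perm_uniq (perm_word _ _)) (subseq_uniq It) ?enum_uniq.
apply/and3P; split.
- apply/andP; split.
    rewrite (permPr (perm_headings tt)) -heads_t.
    have := perm_word t.1.1 t.1.2.
    rewrite -(perm_cat2l (unzip1 (encode t).2)) => /permPr <-.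
    rewrite (word_encode tt) /= perm_sym perm_catCA perm_cat2l perm_sym.
    exact: perm_flatten_blocks.
  have := cut_after_nonempty z (u := a :: inner_list t.1.1 t.1.2) (D := t.2).
  rewrite rcons_cons -wE (cut_encode tt).
  move=> /(_ (subseq_trans Dt (subseq_cons _ _)))/= /andP[_ b2].
  apply/andP; split.
    have := size_head_cut_after (a := a) z _ Dt; rewrite -wE cut_encode //=.
    by apply; move: uw; rewrite wE /= mem_rcons inE => /andP[/norP[]].
  by rewrite all_map; rewrite all_map in b2.
- by rewrite -(size_map fst) [map _ _]headings_encode // size_headings.
- by rewrite heads_t filter_subseq.
Qed.

(** The word is the concatenation of the normal form without its heads. Its letters in the order of
    [enum X] give [I], its arrangement gives [s], and the ends of the pieces give [D]. *)
Lemma encode_inj : {in list_triples &, injective encode}.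
Proof.
move=> t t' tt tt' eqtt'.
have eqw : word t.1.1 t.1.2 = word t'.1.1 t'.1.2.
  by rewrite !word_encode // eqtt'.
have := cut_encode tt; rewrite eqtt' -cut_encode //.
case: t t' tt tt' eqw {eqtt'} => [[I s] D] [[I' s'] D'] /= + + eqw.
rewrite !inE /= => /andP[IX DI] /andP[I'X D'I'].
have uX := enum_uniq X.
have eqI : I = I'.
  apply: val_inj; rewrite /= (subseq_uniqP uX IX) (subseq_uniqP uX I'X).
  apply: eq_filter => x; rewrite -(perm_mem (perm_word I s)) eqw.
  exact: perm_mem (perm_word _ _) x.
subst I'; have eqs : s = s' by apply: word_inj eqw; apply: subseq_uniq uX.
subst s'; have [a [z wE]] := inner_list_word I s.
have sub_w : subseq (inner_list I s) (word I s).
  by rewrite wE (subseq_trans (subseq_rcons _ z)) ?subseq_cons.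
move=> /(congr1 (cut_points a)); rewrite !cut_afterK ?(subseq_trans _ sub_w) //.
by move=> /val_inj->.
Qed.

Lemma encode_surj c : normal_form X k c ->
  exists2 t, t \in list_triples & c = encode t.
Proof.
case: c => b ss /and3P[/andP[perm_bs]].
rewrite [all _ _]/= => /andP[b2 ss2] /eqP sz_ss hX.
pose w := b ++ flatten (unzip2 ss).
have uX := enum_uniq X.
have perm_w : perm_eq (unzip1 ss ++ w) (enum X).
  rewrite -(permPr perm_bs) perm_catCA perm_cat2l perm_sym.
  exact: perm_flatten_blocks.
have uhw : uniq (unzip1 ss ++ w) by rewrite (perm_uniq perm_w).
have := uhw; rewrite cat_uniq => /and3P[_ /hasPn hw uw].
have sub_wX x : x \in w -> x \in enum X.
  by move=> xw; rewrite -(perm_mem perm_w) mem_cat xw orbT.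
have perm_I : perm_eq w [seq x <- enum X | x \in w].
  apply: uniq_perm => // [|x]; first exact: filter_uniq.
  by rewrite mem_filter andb_idr // => /sub_wX.
have szI : size [seq x <- enum X | x \in w] == n.
  rewrite -(perm_size perm_I) -(eqn_add2r k) -cardX -sz_ss cardE.
  by rewrite -(perm_size perm_w) (size_cat (unzip1 ss)) (size_map fst) addnC.
have [s ws] := @word_surj n (Tuple szI) w perm_I.
have [a [z wE]] := inner_list_word (Tuple szI) s.
have ss1 : all (leq 1 \o size) (unzip2 ss).
  by rewrite all_map; rewrite all_map in ss2.
have sub_D : subseq (cut_points a (b :: unzip2 ss)) (inner_list (Tuple szI) s).
  have wE' : b ++ flatten (unzip2 ss) = a :: rcons (inner_list (Tuple szI) s) z.
    by rewrite -wE -ws.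
  (* The first list has at least two letters: removing the initial [a] leaves it nonempty, with the
     same last letter, so the cut points avoid both ends of the word. *)
  case: (b) b2 wE' => [|x [|y b']] // _ [-> wE'].
  apply: (@cut_points_subseq _ a ((y :: b') :: unzip2 ss)) wE'.
  by rewrite /= ss1.
have cut_D : cut_after w (cut_points a (b :: unzip2 ss)) = b :: unzip2 ss.
  by apply: (@cut_pointsK _ a (b :: _)) => //=; rewrite ss1 (ltnW b2).
have szD : size (cut_points a (b :: unzip2 ss)) == k.
  by rewrite -eqSS -(size_cut_after w) cut_D /= size_map sz_ss.
pose t : n.-tuple T * 'S_n * k.-tuple T := (Tuple szI, s, Tuple szD).
exists t; first by rewrite inE /= filter_subseq sub_D.
rewrite /encode /= -ws cut_D /=; congr (_, _).
rewrite -[LHS]zip_unzip; congr zip.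
(* The heads and [w] share out [enum X], so the heads are the complement of [w], in the order of
   [enum X]. *)
rewrite (subseq_uniqP uX hX); apply: eq_in_filter => x xX.
rewrite mem_filter xX andbT.
have := perm_mem perm_w x; rewrite mem_cat xX.
case xw : (x \in w); last by rewrite orbF.
by rewrite (negPf (hw x xw)).
Qed.

Lemma card_distinguished_partitions :
  #|distinguished_partitions k.+1 X| = #|list_triples|.
Proof.
transitivity #|[set decode (encode t) | t in list_triples]|.
  apply: eq_card => z; apply/idP/imsetP => [/decode_surj[c nc ->]|[t tt ->]].
    by have [t tt ->] := encode_surj nc; exists t.
  exact/decode_distinguished/encode_normal.
apply: card_in_imset => t t' tt tt' /decode_inj eqtt'.
by apply: encode_inj => //; apply: eqtt'; apply: encode_normal.
Qed.

(** The number of choices of [D] is the same for all pairs [(I, s)], because [inner_list] always has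
    n-2 distinct entries. The choices of [I] number C(n+k, n) = C(n+k, k). *)
Lemma card_triples : #|list_triples| = n`! * 'C(n - 2, k) * 'C(n + k, k).
Proof.
have uX := enum_uniq X.
rewrite -sum1_card (eq_bigl _ _ (fun t => in_set _ t)).
rewrite -(pair_big_dep (fun a : n.-tuple T * 'S_n => subseq a.1 (enum X))
  (fun a (D : k.-tuple T) => subseq D (inner_list a.1 a.2)) (fun _ _ => 1)) /=.
rewrite (eq_bigr (fun=> 'C(n - 2, k))) => [|[I s] /= IX]; last first.
  have [a [z wE]] := inner_list_word I s.
  have uw : uniq (word I s).
    by rewrite (perm_uniq (perm_word _ _)) (subseq_uniq IX).
  have <- : size (inner_list I s) = n - 2.
    by rewrite -[X in X - 2](size_word I s) wE /= size_rcons subn2.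
  rewrite -card_sublists ?sum1dep_card //.
  by move: uw; rewrite wE /= rcons_uniq => /and3P[].
rewrite sum_nat_const mulnAC; congr (_ * _).
have -> : #|[pred a : n.-tuple T * 'S_n | subseq a.1 (enum X)]| =
    #|setX [set I : n.-tuple T | subseq I (enum X)] [set: 'S_n]|.
  by apply: eq_card => a; rewrite !inE andbT.
rewrite cardsX card_sublists // -cardE cardX cardsT card_Sn mulnC.
by rewrite -[X in 'C(_, X)](addnK k n) bin_sub ?leq_addl.
Qed.

End Triples.

(** * The bijection and the count for the segment *)

(** Turns the equality of cardinalities, itself obtained from [encode] and [decode], into the
    bijection whose existence is asserted. *)
Lemma eq_card_bijective (A B : finType) :
  #|A| = #|B| -> exists f : A -> B, bijective f.
Proof.
move=> eqAB; exists (fun x => enum_val (cast_ord eqAB (enum_rank x))).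
exists (fun y => enum_val (cast_ord (esym eqAB) (enum_rank y))) => x.
  by rewrite enum_valK cast_ordK enum_rankK.
by rewrite enum_valK cast_ordKV enum_rankK.
Qed.

Lemma card_segment m : #|segment m| = m.
Proof.
transitivity #|[set lift ord0 j | j in 'I_m]|; last first.
  by rewrite card_imset ?card_ord //; apply: lift_inj.
apply: eq_card => i; rewrite inE; apply/idP/imsetP => [i0|[j _ ->]] //.
by case: (unliftP ord0 i) i0 => [j ->|->] // _; exists j.
Qed.

Theorem theorem3p1 (n k : nat) (hn : 2 <= n) (hk : 1 <= k <= n - 1) :
  (exists f : {p | p \in distinguished_partitions k (segment (n + k - 1))} ->
              {t | t \in sublist_triples n k},
     bijective f) /\
  #|distinguished_partitions k (segment (n + k - 1))| =
    n`! * 'C(n - 2, k - 1) * 'C(n + k - 1, k - 1).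
Proof.
have k_gt0 : 0 < k by case/andP: hk.
have cardX : #|segment (n + k - 1)| = n + (k - 1).
  by rewrite card_segment addnBA.
have eqD := card_distinguished_partitions hn cardX.
have eqT := card_triples hn cardX.
(* The general count is applied with [k - 1], the number of nondistinguished parts; positivity of
   [k] restores [k] parts in all. *)
rewrite (_ : (k - 1).+1 = k) in eqD; last by rewrite subn1 prednK.
split; last by rewrite eqD eqT addnBA.
by apply: eq_card_bijective; rewrite !card_sig.
Qed.
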